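(* Let $u$ be a nonconstant inner function. Then the dual of the compressed shift, $D_u:\mathcal{K}_u^\perp\to\mathcal{K}_u^\perp$, $D_u h=(I-P_{\mathcal{K}_u})(zh)$, is norm attaining: there exists a nonzero $h\in\mathcal{K}_u^\perp$ with $\|D_u h\|=\|D_u\|\,\|h\|$.
   Context: $\mathbb{T}$ is the unit circle with normalized arc-length measure, $L^2=L^2(\mathbb{T})$, $H^2\subset L^2$ is the Hardy space of functions whose Fourier coefficients of negative index vanish, $H^2_-=L^2\ominus H^2$. An inner function is a bounded $u\in H^2$ with $|u|=1$ a.e. on $\mathbb{T}$. The model space is $\mathcal{K}_u=H^2\ominus uH^2$, its orthogonal complement in $L^2$ is $\mathcal{K}_u^\perp=uH^2\oplus H^2_-$, and $P_{\mathcal{K}_u}$ is the orthogonal projection of $L^2$ onto $\mathcal{K}_u$. Here $z$ denotes the coordinate function $z=e^{it}$ on $\mathbb{T}$. *)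

(* Defs.v *)
From HB Require Import structures.
From mathcomp Require Import all_boot all_order all_algebra.
From mathcomp Require Import complex.
From mathcomp Require Import all_classical all_reals all_analysis.

Set Implicit Arguments.
Unset Strict Implicit.
Unset Printing Implicit Defensive.

Import Order.TTheory GRing.Theory Num.Theory.
Import numFieldNormedType.Exports.

Local Open Scope classical_set_scope.
Local Open Scope complex_scope.
Local Open Scope ring_scope.

Section CircleHardySpace.
Context {R : realType}.
Local Notation C := R[i].
Implicit Types (f g u : R -> C) (V W : set (R -> C)).

Lemma twopi_gt0 : 0 < 2 * pi :> R.
Proof. by rewrite mulr_gt0// pi_gt0. Qed.

(* The circle is parametrised by the angle: a function f on the circle is
   represented by t |-> f (e^{it}) on [0, 2 pi], whose normalized Lebesgue
   measure is normalized arc length. Values outside [0, 2 pi] are irrelevant.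
   Elements of L^2 are measurable representatives: they are understood modulo
   a.e. equality for this measure, which all notions below respect. *)
Definition arc_measure : probability (measurableTypeR R) R :=
  uniform_prob twopi_gt0.

Definition zT : R -> C := fun t => cos t +i* sin t.

Definition L2 : set (R -> C) :=
  [set f : R -> C | (fun t => complex.Re (f t)) \in Lfun arc_measure 2%:E /\
                    (fun t => complex.Im (f t)) \in Lfun arc_measure 2%:E].

Definition cintegral f : C :=
  (\int[arc_measure]_t complex.Re (f t)) +i*
  (\int[arc_measure]_t complex.Im (f t)).

Definition dotL2 f g : C := cintegral (fun t => f t * conjc (g t)).

Definition normL2 f : \bar R :=
  'N[arc_measure]_2%:E[EFin \o (fun t => Normc.normc (f t))].

Definition fourier f (n : int) : C := dotL2 f (fun t => zT t ^ n).

Definition H2 : set (R -> C) :=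
  [set f : R -> C | L2 f /\ forall n : int, n < 0 -> fourier f n = 0].

(* The orthogonal difference V \ominus W. *)
Definition orthodiff V W : set (R -> C) :=
  [set f : R -> C | V f /\ forall g, W g -> dotL2 f g = 0].

Definition inner_function u : Prop :=
  [/\ H2 u,
      exists M : R, {ae arc_measure, forall t, Normc.normc (u t) <= M} &
      {ae arc_measure, forall t, Normc.normc (u t) = 1}].

Definition nonconstant u : Prop :=
  ~ exists c : C, {ae arc_measure, forall t, u t = c}.

Definition model_space u : set (R -> C) :=
  orthodiff H2 [set u \* f | f in H2].

Definition model_space_perp u : set (R -> C) := orthodiff L2 (model_space u).

(* A representative of the orthogonal projection of f onto V: some p in V with
   f - p orthogonal to V. For f in L^2 and V a closed subspace such a p exists
   and is unique modulo a.e. equality; the default value 0 is used only when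
   there is none. *)
Definition orthoproj V f : R -> C :=
  xget (cst 0) [set p | V p /\ orthodiff L2 V (f \- p)].

Definition dual_compressed_shift u f : R -> C :=
  (zT \* f) \- orthoproj (model_space u) (zT \* f).

Definition opnorm V (A : (R -> C) -> R -> C) : \bar R :=
  ereal_sup
    [set normL2 (A f) | f in [set f : R -> C | V f /\ (normL2 f <= 1)%E]].

End CircleHardySpace.

(* Main.v *)
Require Import Defs.
From mathcomp Require Import all_boot all_order all_algebra.
From mathcomp Require Import complex.
From mathcomp Require Import all_classical all_reals all_analysis.
From mathcomp Require Import measurable_realfun ring lra.

Set Implicit Arguments.
Unset Strict Implicit.
Unset Printing Implicit Defensive.

Local Open Scope classical_set_scope.
Local Open Scope complex_scope.
Local Open Scope ring_scope.

Import Order.TTheory GRing.Theory Num.Theory.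
Import numFieldNormedType.Exports.

(** The norm of the dual of the compressed shift is attained at h = u.

    Multiplication by z is an isometry and subtracting an orthogonal projection
    does not increase the norm, so the operator norm is at most 1. Both u and zu
    lie in uH^2, because the monomials 1 and z are in H^2, hence both are
    orthogonal to the model space. Therefore u belongs to the domain, the
    projection of zu vanishes almost everywhere, and the image of u has the norm
    of zu, which is 1 since u is unimodular.

    The analytic input is that the nonnegative powers of z belong to H^2
    ([H2_zTX]), that is, that the nonconstant characters of the circle have mean
    zero ([cintegral_zTS]). The geometric input is Pythagoras' identity
    ([Re_dotL2_orthoD]), applied to a vector f and a representative p of its
    projection, f = (f - p) + p, in [normL2_sub_orthoproj_le] and
    [normL2_sub_orthoproj_eq]. Both hold whether or not a projection of f exists,
    since otherwise the default value 0 is subtracted from f. *)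

(** * Characters of the circle *)

Lemma bounded_Lfun d (T : measurableType d) (R : realType)
    (mu : {finite_measure set T -> \bar R}) (r M : R) (g : T -> R) :
  0 <= r -> measurable_fun setT g -> (forall t, `|g t| <= M) ->
  g \in Lfun mu r%:E.
Proof.
move=> r0 mg gM; rewrite inE/=; apply/andP; split; rewrite inE//=.
rewrite /finite_norm unlock poweR_lty//=.
apply: (@le_lt_trans _ _ (\int[mu]_x (M `^ r)%:E)%E); last first.
  rewrite integral_cst// ltey_eq fin_numM//.
  exact: fin_num_measure.
apply: ge0_le_integral => //.
- apply/measurable_EFinP.
  apply: (@measurableT_comp _ _ _ _ _ _ (@powR R ^~ r)) => //.
  exact: measurableT_comp.
- move=> x _; rewrite lee_fin ge0_ler_powR//.
  by rewrite nnegrE (le_trans _ (gM x)).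
Qed.

Section circle.
Context {R : realType}.
Implicit Types (f g p q u : R -> R[i]) (x y : R -> R)
  (V : set (R -> R[i])).
Local Notation mu := (@arc_measure R).

Lemma Rintegral_arc_cst (c : R) : \int[mu]_t c = c.
Proof.
rewrite Rintegral_cst// -[RHS]mulr1; congr (_ * _).
exact: (congr1 fine (probability_setT mu)).
Qed.

(** The fundamental theorem of calculus over one period of the primitive y. The
    change of variables from the uniform probability to Lebesgue measure is for
    nonnegative integrands, hence the detour through 1 + x. *)
Lemma Rintegral_arc_periodic x y :
  continuous x -> (forall t, `|x t| <= 1) ->
  (forall t, is_derive t (1 : R) y (x t)) -> y (2 * pi) = y 0 ->
  \int[mu]_t x t = 0.
Proof.
move=> cx x1 dy yper.
have mx : measurable_fun setT x by exact: continuous_measurable_fun.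
have ix : mu.-integrable setT (EFin \o x).
  apply/Lfun1_integrable; exact: (@bounded_Lfun _ _ _ _ 1 1).
have x0 t : (0 <= (1 + x t)%:E)%E.
  by rewrite lee_fin; have := x1 t; rewrite ler_norml => /andP[]; lra.
have cst_int : mu.-integrable setT (EFin \o cst 1).
  exact: finite_measure_integrable_cst.
have e1 : \int[mu]_t (1 + x t) = 1 + \int[mu]_t x t.
  by rewrite RintegralD// Rintegral_arc_cst.
have e2 : \int[mu]_t (1 + x t) = 1.
  rewrite /Rintegral integral_uniform//; last first.
    by apply/measurable_EFinP; exact: measurable_funD.
  have dF t : is_derive t (1 : R) (id \+ y) (1 + x t) by exact: is_deriveD.
  rewrite (@continuous_FTC2 _ _ (id \+ y))//.
  - rewrite /= yper subr0 add0r addrK mulVf// gt_eqF//.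
    exact: twopi_gt0.
  - exact: twopi_gt0.
  - apply: continuous_subspaceT => t; apply: cvgD; [exact: cvg_cst|exact: cx].
  - have cF : continuous (id \+ y).
      move=> t; apply: differentiable_continuous.
      by apply/derivable1_diffP; apply: ex_derive.
    split.
    + by move=> t _; apply: ex_derive.
    + exact: cvg_at_right_filter (cF _).
    + exact: cvg_at_left_filter (cF _).
  - by move=> t _; rewrite derive1E; apply: derive_val.
by apply: (addrI 1); rewrite addr0 -e1.
Qed.

Lemma zTX_cos_sin (t : R) n : zT t ^+ n = cos (n%:R * t) +i* sin (n%:R * t).
Proof.
elim: n => [|n IHn]; first by rewrite expr0 mul0r cos0 sin0.
rewrite exprS IHn -natr1 mulrDl mul1r cosD sinD /zT.
by apply/eqP; rewrite eq_complex /=; apply/andP; split; apply/eqP; ring.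
Qed.

Lemma normc_zT (t : R) : Normc.normc (zT t) = 1.
Proof. by rewrite /zT /= cos2Dsin2 sqrtr1. Qed.

Lemma conjc_zT (t : R) : conjc (zT t) = (zT t)^-1.
Proof.
have z0 : zT t != 0.
  by apply/eqP => z0; have := normc_zT t; rewrite z0 Normc.normc0; lra.
apply: (mulIf z0); rewrite mulVf//.
apply/eqP; rewrite eq_complex /=; have := cos2Dsin2 t; rewrite !expr2 => h.
by apply/andP; split; apply/eqP; lra.
Qed.

Lemma cos_sin_2piMn n : cos (n%:R * (2 * pi)) = 1 :> R /\
  sin (n%:R * (2 * pi)) = 0 :> R.
Proof.
have e : zT (2 * pi) = 1 :> R[i].
  by rewrite /zT mulrC mulr_natr cos2pi sin2pi.
by have := zTX_cos_sin (2 * pi) n; rewrite e expr1n => -[<- <-].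
Qed.

Lemma continuous_cosM (a : R) : continuous (fun t => cos (a * t)).
Proof.
move=> t; apply: (@continuous_comp _ _ _ (fun t => a * t) cos).
  exact: mulrl_continuous.
exact: continuous_cos.
Qed.

Lemma continuous_sinM (a : R) : continuous (fun t => sin (a * t)).
Proof.
move=> t; apply: (@continuous_comp _ _ _ (fun t => a * t) sin).
  exact: mulrl_continuous.
exact: continuous_sin.
Qed.

Lemma is_derive_comp_mull (a t : R) (G : R -> R) (dG : R) :
  is_derive (a * t) (1 : R) G dG ->
  is_derive t (1 : R) (fun t => G (a * t)) (a * dG).
Proof.
move=> dGt.
have da : is_derive t (1 : R) ( *%R a) a.
  have h : is_derive t (1 : R) (a \*: @id R) (a *: 1) by exact: is_deriveZ.
  by rewrite /GRing.scale /= mulr1 in h.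
by rewrite mulrC; apply: (@is_derive1_comp R G ( *%R a)) => //; exact: dGt.
Qed.

Lemma cintegral_zTS n : cintegral (fun t : R => zT t ^+ n.+1) = 0.
Proof.
have [c1 s0] := cos_sin_2piMn n.+1.
have n0 : n.+1%:R != 0 :> R by rewrite pnatr_eq0.
rewrite /cintegral; apply/eqP; rewrite eq_complex /=.
apply/andP; split; apply/eqP.
- under eq_Rintegral do rewrite zTX_cos_sin /=.
  apply: (@Rintegral_arc_periodic _
    (fun t => n.+1%:R^-1 * sin (n.+1%:R * t))).
  + exact: continuous_cosM.
  + by move=> t; exact: cos_max.
  + move=> t; have := is_derive_comp_mull (is_derive_sin _) => ds.
    by apply: is_derive_eq; rewrite /GRing.scale /= mulrA mulVf// mul1r.
  + by rewrite s0 !mulr0 sin0 mulr0.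
- under eq_Rintegral do rewrite zTX_cos_sin /=.
  apply: (@Rintegral_arc_periodic _
    (fun t => - n.+1%:R^-1 * cos (n.+1%:R * t))).
  + exact: continuous_sinM.
  + by move=> t; exact: sin_max.
  + move=> t; have := is_derive_comp_mull (is_derive_cos _) => ds.
    apply: is_derive_eq.
    by rewrite /GRing.scale /= mulrA mulNr mulrNN mulVf// mul1r.
  + by rewrite c1 mulr0 cos0.
Qed.

Lemma L2_zTX n : L2 (fun t : R => zT t ^+ n).
Proof.
split; apply: (@bounded_Lfun _ _ _ _ 2 1) => //.
- under eq_fun do rewrite zTX_cos_sin /=.
  apply: continuous_measurable_fun; exact: continuous_cosM.
- by move=> t; rewrite zTX_cos_sin; exact: cos_max.
- under eq_fun do rewrite zTX_cos_sin /=.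
  apply: continuous_measurable_fun; exact: continuous_sinM.
- by move=> t; rewrite zTX_cos_sin; exact: sin_max.
Qed.

(** On the circle the conjugate of z^n is z^(-n), so a Fourier coefficient of z^n
    of negative index is the mean of a positive power of z. *)
Lemma H2_zTX n : H2 (fun t : R => zT t ^+ n).
Proof.
split; first exact: L2_zTX.
case=> // m _; rewrite /fourier /dotL2 -[RHS](cintegral_zTS (n + m)).
congr cintegral; apply/funext => t.
have zTX_conj : conjc (zT t ^+ m.+1) = (conjc (zT t)) ^+ m.+1.
  exact: rmorphXn.
rewrite NegzE -exprnN conjc_inv zTX_conj conjc_zT.
by rewrite exprVn invrK -exprD addnS.
Qed.

(** * The real inner product on L^2 *)

(** The real part of the inner product is a symmetric bilinear form that already
    determines the norm; working with it keeps conjugation out of the geometric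
    arguments. *)
Lemma Re_dotL2 f g : complex.Re (dotL2 f g) =
  \int[mu]_t (complex.Re (f t) * complex.Re (g t) +
              complex.Im (f t) * complex.Im (g t)).
Proof.
apply: eq_Rintegral => t _.
by case: (f t) (g t) => [a b] [c d] /=; rewrite mulrN opprK.
Qed.

Lemma Im_dotL2 f g : complex.Im (dotL2 f g) =
  \int[mu]_t (complex.Im (f t) * complex.Re (g t) -
              complex.Re (f t) * complex.Im (g t)).
Proof.
apply: eq_Rintegral => t _.
by case: (f t) (g t) => [a b] [c d] /=; rewrite mulrN addrC mulrC.
Qed.

Lemma integrable_Lfun2M x y :
  x \in Lfun mu 2%:E -> y \in Lfun mu 2%:E ->
  mu.-integrable setT (EFin \o (x \* y)).
Proof. by move=> x2 y2; apply/Lfun1_integrable; exact: Lfun2_mul_Lfun1. Qed.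

Lemma integrable_Re_dot f g : L2 f -> L2 g ->
  mu.-integrable setT (EFin \o (fun t =>
    complex.Re (f t) * complex.Re (g t) + complex.Im (f t) * complex.Im (g t))).
Proof.
move=> [f1 f2] [g1 g2].
exact: (integrableD measurableT (integrable_Lfun2M f1 g1)
                                (integrable_Lfun2M f2 g2)).
Qed.

Lemma Re_dotL2C f g : complex.Re (dotL2 f g) = complex.Re (dotL2 g f).
Proof.
rewrite !Re_dotL2; apply: eq_Rintegral => t _.
by congr (_ + _); exact: mulrC.
Qed.

Lemma dotL2_eq0C f g : L2 f -> L2 g -> dotL2 f g = 0 -> dotL2 g f = 0.
Proof.
move=> [f1 f2] [g1 g2] fg0.
have /eqP : complex.Im (dotL2 f g) + complex.Im (dotL2 g f) = 0.
  rewrite !Im_dotL2 -RintegralD//; last 2 first.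
  - exact: (integrableB measurableT (integrable_Lfun2M f2 g1)
                                    (integrable_Lfun2M f1 g2)).
  - exact: (integrableB measurableT (integrable_Lfun2M g2 f1)
                                    (integrable_Lfun2M g1 f2)).
  rewrite -[RHS]Rintegral_arc_cst; apply: eq_Rintegral => t _; ring.
rewrite fg0 add0r => im0.
by apply/eqP; rewrite eq_complex im0 -Re_dotL2C fg0 /= eqxx.
Qed.

Lemma L2D f g : L2 f -> L2 g -> L2 (f \+ g).
Proof.
move=> [f1 f2] [g1 g2]; split.
- have -> : (fun t => complex.Re ((f \+ g) t)) =
      (fun t => complex.Re (f t)) + (fun t => complex.Re (g t)).
    by apply/funext => t; rewrite /= raddfD.
  exact: (Lfun_addr_closed mu (lee1n 2)).2.
- have -> : (fun t => complex.Im ((f \+ g) t)) =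
      (fun t => complex.Im (f t)) + (fun t => complex.Im (g t)).
    by apply/funext => t; rewrite /= raddfD.
  exact: (Lfun_addr_closed mu (lee1n 2)).2.
Qed.

Lemma Re_dotL2Dr f g h : L2 f -> L2 g -> L2 h ->
  complex.Re (dotL2 f (g \+ h)) =
  complex.Re (dotL2 f g) + complex.Re (dotL2 f h).
Proof.
move=> fL gL hL; rewrite !Re_dotL2 -RintegralD//; last 2 first.
- exact: integrable_Re_dot.
- exact: integrable_Re_dot.
apply: eq_Rintegral => t _ /=.
by case: (f t) (g t) (h t) => [a b] [c d] [e k] /=; ring.
Qed.

Lemma Re_dotL2_ge0 f : 0 <= complex.Re (dotL2 f f).
Proof.
rewrite Re_dotL2; apply: Rintegral_ge0 => t _.
by rewrite addr_ge0// -expr2 sqr_ge0.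
Qed.

Lemma normL2E f : L2 f -> normL2 f = (Num.sqrt (complex.Re (dotL2 f f)))%:E.
Proof.
move=> fL.
have fi := integrable_Re_dot fL fL.
rewrite /normL2 unlock -powR12_sqrt ?Re_dotL2_ge0// -poweR_EFin.
congr (_ `^ _)%E.
rewrite Re_dotL2 /Rintegral fineK; last exact: integrable_fin_num.
apply: eq_integral => t _.
rewrite /= powR_mulrn//; congr EFin.
rewrite real_normK ?num_real//.
by case: (f t) => a b /=; rewrite sqr_sqrtr ?addr_ge0 ?sqr_ge0// !expr2.
Qed.

Lemma normL2_zTM f : normL2 (zT \* f) = normL2 f.
Proof.
apply: eq_Lnorm => t /=.
by rewrite Normc.normcM normc_zT mul1r.
Qed.

Lemma Re_dotL2_orthoD q p : L2 q -> L2 p -> dotL2 q p = 0 ->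
  complex.Re (dotL2 (q \+ p) (q \+ p)) =
  complex.Re (dotL2 q q) + complex.Re (dotL2 p p).
Proof.
move=> qL pL qp0; have qpL := L2D qL pL.
rewrite Re_dotL2Dr// ![complex.Re (dotL2 (q \+ p) _)]Re_dotL2C.
by rewrite !Re_dotL2Dr// [complex.Re (dotL2 p q)]Re_dotL2C qp0 /= addr0 add0r.
Qed.

(** * Unimodular functions *)

Lemma normL2_unimodular u : L2 u ->
  {ae mu, forall t, Normc.normc (u t) = 1} -> normL2 u = 1%E.
Proof.
move=> uL u1; rewrite normL2E// (_ : complex.Re _ = 1) ?sqrtr1//.
rewrite Re_dotL2 -[RHS]Rintegral_arc_cst; congr fine.
apply: ae_eq_integral => //.
- by have /integrableP[] := integrable_Re_dot uL uL.
- apply: filterS u1; first exact: (ae_filter_ringOfSetsType mu).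
  move=> t /= + _.
  case: (u t) => a b /= ab1; congr EFin.
  by rewrite -!expr2 -[LHS]sqr_sqrtr ?addr_ge0 ?sqr_ge0// ab1 expr1n.
Qed.

Lemma unimodular_neq0 u : {ae mu, forall t, Normc.normc (u t) = 1} ->
  ~ {ae mu, forall t, u t = 0}.
Proof.
move=> u1 u0.
have : {ae mu, forall t : R, False}.
  apply: filterS2 u1 u0; first exact: (ae_filter_ringOfSetsType mu).
  move=> t /[swap] ->; rewrite Normc.normc0 => /eqP.
  by rewrite eq_sym oner_eq0.
rewrite /almost_everywhere/= => /negligibleP.
rewrite setC0 => /(_ measurableT) mu0.
by have /eqP := etrans (esym (probability_setT mu)) mu0; rewrite eqe oner_eq0.
Qed.

(** * Subtracting an orthogonal projection *)

Lemma normL2_sub_orthoproj_le V f : V `<=` L2 ->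
  (normL2 (f \- orthoproj V f)%R <= normL2 f)%E.
Proof.
move=> VL2; rewrite /orthoproj.
case: xgetP => [p _ [Vp [qL qV]]|_]; last first.
  by rewrite (_ : f \- cst 0 = f)//; apply/funext => t; rewrite /= subr0.
have pL := VL2 _ Vp.
have fE : f = (f \- p) \+ p by apply/funext => t; rewrite /= subrK.
move: (f \- p) qL qV fE => q qL qV ->.
rewrite !normL2E//; last exact: L2D.
rewrite lee_fin ler_wsqrtr// Re_dotL2_orthoD//; last exact: qV.
by rewrite lerDl Re_dotL2_ge0.
Qed.

(** A representative p of the projection of a vector f orthogonal to V is orthogonal
    to both f and f - p, hence to itself, so subtracting it loses no norm. *)
Lemma normL2_sub_orthoproj_eq V f : V `<=` L2 ->
  (forall g, V g -> dotL2 g f = 0) -> normL2 (f \- orthoproj V f) = normL2 f.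
Proof.
move=> VL2 fV; rewrite /orthoproj.
case: xgetP => [p _ [Vp [qL qV]]|_]; last first.
  by congr normL2; apply/funext => t; rewrite /= subr0.
have pL := VL2 _ Vp.
have fE : f = (f \- p) \+ p by apply/funext => t; rewrite /= subrK.
move: (f \- p) qL qV fE fV => q qL qV -> fV.
have pp0 : complex.Re (dotL2 p p) = 0.
  have := congr1 (@complex.Re R) (fV _ Vp).
  by rewrite Re_dotL2Dr// Re_dotL2C qV//= add0r.
rewrite !normL2E//; last exact: L2D.
rewrite Re_dotL2_orthoD ?pp0 ?addr0//; exact: qV.
Qed.

End circle.

(** * The dual of the compressed shift *)

Theorem mainTheorem3 (R : realType) (u : R -> R[i])
    (u_inner : inner_function u) (u_nonconst : nonconstant u) :
  exists h : R -> R[i],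
    [/\ model_space_perp u h,
        ~ {ae arc_measure, forall t, h t = 0} &
        normL2 (dual_compressed_shift u h) =
          (opnorm (model_space_perp u) (dual_compressed_shift u) *
           normL2 h)%E].
Proof.
have [[uL _] _ u1] := u_inner.
have KL2 : model_space u `<=` L2 by move=> g [[]].
(* u = u * 1 and zu = u * z are in uH^2. *)
have u_perp : model_space_perp u u.
  split=> // g Kg; apply: dotL2_eq0C => //; first exact: KL2.
  apply: Kg.2; exists (fun t => zT t ^+ 0); first exact: H2_zTX.
  by apply/funext => t; rewrite /= expr0 mulr1.
have zu_perp g : model_space u g -> dotL2 g (zT \* u) = 0.
  move=> Kg; apply: Kg.2; exists (fun t => zT t ^+ 1); first exact: H2_zTX.
  by apply/funext => t; rewrite /= expr1 mulrC.
have nu1 : normL2 u = 1%E by exact: normL2_unimodular.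
have nDu : normL2 (dual_compressed_shift u u) = 1%E.
  by rewrite /dual_compressed_shift normL2_sub_orthoproj_eq// normL2_zTM.
exists u; split => //; first exact: unimodular_neq0.
rewrite nu1 mule1 nDu; apply/eqP; rewrite eq_le; apply/andP; split.
  by apply: ereal_sup_ubound; exists u => //; split; rewrite ?nu1.
apply: ge_ereal_sup => _ [f [_ f1] <-].
apply: le_trans f1; rewrite -(normL2_zTM f).
exact: normL2_sub_orthoproj_le.
Qed.
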